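(* Let $G$ be a (crown, $P_3\cup P_2$)-free graph. Then $\chi(G)\le \frac{1}{2}\omega^2(G)+\frac{3}{2}\omega(G)+1$.
   Context: All graphs are finite and simple. $\chi(G)$ is the chromatic number and $\omega(G)$ the clique number of $G$; $\omega^2(G)$ means $(\omega(G))^2$. $P_k$ is the path on $k$ vertices, and $P_3\cup P_2$ is the disjoint union of $P_3$ and $P_2$ (no edges between them). The crown is the graph $K_1+K_{1,3}$, i.e. the claw $K_{1,3}$ together with a new vertex adjacent to all four vertices of $K_{1,3}$. A graph is $(F_1,F_2)$-free if it has no induced subgraph isomorphic to $F_1$ or to $F_2$. *)

(* Defs.v *)
From mathcomp Require Import all_boot.

Set Implicit Arguments.
Unset Strict Implicit.
Unset Printing Implicit Defensive.

Record sgraph := SGraph {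
  vertex :> finType;
  adj : rel vertex;
  adj_sym : symmetric adj;
  adj_irrefl : irreflexive adj }.

Definition isomorphic (G H : sgraph) : Prop :=
  exists2 f : G -> H, bijective f & forall x y, adj (f x) (f y) = adj x y.

Section InducedSubgraph.
Variables (G : sgraph) (A : {set G}).

Definition induced_adj : rel {x : G | x \in A} :=
  fun x y => adj (val x) (val y).

Lemma induced_adj_sym : symmetric induced_adj.
Proof. by move=> x y; rewrite /induced_adj adj_sym. Qed.

Lemma induced_adj_irrefl : irreflexive induced_adj.
Proof. by move=> x; rewrite /induced_adj adj_irrefl. Qed.

Definition induced : sgraph := SGraph induced_adj_sym induced_adj_irrefl.
End InducedSubgraph.

Definition induced_free (F G : sgraph) : Prop :=
  forall A : {set G}, ~ isomorphic (induced A) F.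

Section Operations.
Variables G H : sgraph.

Definition disjoint_union_adj : rel (G + H)%type := fun u v =>
  match u, v with
  | inl x, inl y => adj x y
  | inr x, inr y => adj x y
  | _, _ => false
  end.

Lemma disjoint_union_adj_sym : symmetric disjoint_union_adj.
Proof. by case=> x [] y //=; rewrite adj_sym. Qed.

Lemma disjoint_union_adj_irrefl : irreflexive disjoint_union_adj.
Proof. by case=> x /=; rewrite adj_irrefl. Qed.

Definition disjoint_union : sgraph :=
  SGraph disjoint_union_adj_sym disjoint_union_adj_irrefl.

Definition join_adj : rel (G + H)%type := fun u v =>
  match u, v with
  | inl x, inl y => adj x y
  | inr x, inr y => adj x y
  | _, _ => true
  end.

Lemma join_adj_sym : symmetric join_adj.
Proof. by case=> x [] y //=; rewrite adj_sym. Qed.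

Lemma join_adj_irrefl : irreflexive join_adj.
Proof. by case=> x /=; rewrite adj_irrefl. Qed.

Definition graph_join : sgraph := SGraph join_adj_sym join_adj_irrefl.
End Operations.

Section BasicGraphs.
Variable n : nat.

Definition edgeless_adj : rel 'I_n := fun _ _ => false.

Lemma edgeless_adj_sym : symmetric edgeless_adj.
Proof. by []. Qed.

Lemma edgeless_adj_irrefl : irreflexive edgeless_adj.
Proof. by []. Qed.

Definition edgeless_graph : sgraph := SGraph edgeless_adj_sym edgeless_adj_irrefl.

Definition complete_adj : rel 'I_n := fun i j => i != j.

Lemma complete_adj_sym : symmetric complete_adj.
Proof. by move=> i j; rewrite /complete_adj eq_sym. Qed.

Lemma complete_adj_irrefl : irreflexive complete_adj.
Proof. by move=> i; rewrite /complete_adj eqxx. Qed.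

Definition complete_graph : sgraph := SGraph complete_adj_sym complete_adj_irrefl.

Definition path_adj : rel 'I_n :=
  fun i j => (i.+1 == j :> nat) || (j.+1 == i :> nat).

Lemma path_adj_sym : symmetric path_adj.
Proof. by move=> i j; rewrite /path_adj orbC. Qed.

Lemma path_adj_irrefl : irreflexive path_adj.
Proof. by move=> i; rewrite /path_adj orbb gtn_eqF. Qed.

(* The path P_n on n vertices (not n edges). *)
Definition path_graph : sgraph := SGraph path_adj_sym path_adj_irrefl.
End BasicGraphs.

Definition complete_bipartite (m n : nat) : sgraph :=
  graph_join (edgeless_graph m) (edgeless_graph n).

Definition crown : sgraph := graph_join (complete_graph 1) (complete_bipartite 1 3).

Section Invariants.
Variable G : sgraph.

Definition clique (A : {set G}) : bool :=
  [forall x in A, forall y in A, (x != y) ==> adj x y].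

Definition clique_number : nat := \max_(A : {set G} | clique A) #|A|.

Definition proper_coloring (k : nat) (c : {ffun G -> 'I_k}) : bool :=
  [forall x, forall y, adj x y ==> (c x != c y)].

Definition colorable (k : nat) : bool :=
  [exists c : {ffun G -> 'I_k}, proper_coloring c].

Lemma ex_colorable : exists k, colorable k.
Proof.
exists #|G|; apply/existsP; exists [ffun x => enum_rank x].
apply/forallP=> x; apply/forallP=> y; apply/implyP=> xy.
rewrite !ffunE (inj_eq enum_rank_inj).
by apply/eqP=> exy; rewrite exy adj_irrefl in xy.
Qed.

Definition chromatic_number : nat := ex_minn ex_colorable.
End Invariants.

(* Main.v *)
Require Import Defs.
From mathcomp Require Import all_boot all_order all_algebra.
From mathcomp Require Import zify lra.

Set Implicit Arguments.
Unset Strict Implicit.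
Unset Printing Implicit Defensive.

(** Write w for the clique number, N(x) for the neighbourhood of x, and let
    C(n, 2) be the binomial coefficient.  Suppose that G has a triangle u v t.
    The vertices other than u fall into three sets, coloured with disjoint
    palettes.

    - N(u).  For a in N(u), crown-freeness of the edge u a says that
      N(u) :&: N(a) has no independent triple, and its cliques have at most
      w - 2 vertices.  By the bound R(3, w - 1) <= C(w, 2) it has fewer than
      C(w, 2) vertices, so greedy colouring gives N(u) at most C(w, 2) colours
      ([colors_in_nbh]).

    - The vertices adjacent to neither u nor v.  An induced P3 among them would
      form a P3 + P2 with the edge u v, so they induce a disjoint union of
      cliques, which takes w colours ([colors_in_no_P3]).

    - Y, the set of neighbours of v not adjacent to u.  This is the main step,
      [colors_in_nbhD]: Y takes only w - 1 colours.  Indeed C = Y :&: N(t) is a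
      clique, because two nonadjacent vertices of C would form with u an
      independent triple adjacent to both v and t; D = Y :\: N(t) induces no
      P3 because of the edge u t; and a vertex x of C is adjacent to an end of
      every edge of D, for otherwise that edge and the path u t x would form a
      P3 + P2.  Give distinct colours to the vertices of C.  A vertex of D
      which is not complete to C repeats the colour of a vertex of C that it
      misses; the last property makes this proper.  The vertices of D complete
      to C induce a disjoint union of cliques, each of which extends C to a
      clique of Y, hence w - 1 - |C| fresh colours suffice for them.

    One more colour for u gives C(w, 2) + 2 w, and
    C(w + 2, 2) = C(w, 2) + 2 w + 1 is the claimed bound.  When w = 2 the set Y
    is independent and one colour is enough for it; when w <= 1 there is no
    edge at all. *)

(** * Forbidden configurations, cliques and partial colourings *)

Definition nbh (G : sgraph) (x : G) : {set G} := [set y | adj x y].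

Definition anti (G : sgraph) (x y : G) : bool := (x != y) && ~~ adj x y.

Definition no_indep3 (G : sgraph) (A : {set G}) : Prop :=
  forall x y z, x \in A -> y \in A -> z \in A ->
    anti x y -> anti x z -> anti y z -> False.

Definition no_P3 (G : sgraph) (A : {set G}) : Prop :=
  forall x y z, x \in A -> y \in A -> z \in A ->
    adj x y -> adj y z -> anti x z -> False.

Definition cliques_le (G : sgraph) (A : {set G}) (k : nat) : Prop :=
  forall Q : {set G}, Q \subset A -> clique Q -> #|Q| <= k.

(** Colours are plain naturals, and only the vertices of A are constrained;
    this lets partial colourings be shifted and glued without casts. *)
Definition colors_in (G : sgraph) (A : {set G}) (k : nat) : Prop :=
  exists c : G -> nat, (forall x, x \in A -> c x < k) /\
    (forall x y, x \in A -> y \in A -> adj x y -> c x != c y).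

(** * Induced copies of the two forbidden graphs *)

Lemma embedding_isomorphic (F G : sgraph) (g : F -> G) :
  injective g -> (forall x y, adj (g x) (g y) = adj x y) ->
  isomorphic (induced [set g x | x in [set: F]]) F.
Proof.
move=> g_inj g_adj.
have gP (x : F) : g x \in [set g x | x in [set: F]] by apply: imset_f; rewrite inE.
pose h (x : F) : induced [set g x | x in [set: F]] := exist _ (g x) (gP x).
have h_inj : injective h by move=> x y /(congr1 val) /g_inj.
(* Equal cardinals turn the injection h into a bijection; its inverse is the
   isomorphism wanted. *)
have h_card : #|induced [set g x | x in [set: F]]| <= #|F|.
  by rewrite card_sig (eq_card (B := [set g x | x in [set: F]])) ?card_imset ?cardsT.
have [f hK fK] := inj_card_bij h_inj h_card.
exists f; first by exists h.
by move=> x y; rewrite -{2}(fK x) -{2}(fK y) /= /induced_adj /= g_adj.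
Qed.

Lemma adj_neq (G : sgraph) (x y : G) : adj x y -> x != y.
Proof. by apply: contraTneq => ->; rewrite adj_irrefl. Qed.

(** The crown is an edge completely joined to three independent vertices. *)
Lemma crown_free_no_indep3 (G : sgraph) (u v : G) :
  induced_free crown G -> adj u v -> no_indep3 (nbh u :&: nbh v).
Proof.
move=> free uv x y z; rewrite !inE => /andP[ux vx] /andP[uy vy] /andP[uz vz].
move=> /andP[xy /negbTE nxy] /andP[xz /negbTE nxz] /andP[yz /negbTE nyz].
pose g (t : crown) : G := match t with
  | inl _ => u
  | inr (inl _) => v
  | inr (inr i) => nth x [:: x; y; z] i
  end.
have g_adj s t : adj (g s) (g t) = adj s t.
  case: s => [i|[i|[[|[|[|i]]] Hi]]] //; case: t => [j|[j|[[|[|[|j]]] Hj]]] //=;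
    rewrite ?(ord1 i) ?(ord1 j) /complete_adj /edgeless_adj ?eqxx ?adj_irrefl //;
    rewrite // adj_sym //.
apply: (free _ (embedding_isomorphic (g := g) _ g_adj)) => s t gst.
(* The adjacencies of g already separate all vertices except the three leaves. *)
have: adj s t = false by rewrite -g_adj gst adj_irrefl.
case: s gst => [i|[i|i]]; case: t => [j|[j|j]] //= gst _; rewrite ?(ord1 i) ?(ord1 j) //.
congr (inr (inr _)); apply: val_inj; apply/eqP.
by rewrite -(nth_uniq x (s := [:: x; y; z])) ?gst //= !inE negb_or xy xz yz.
Qed.

Lemma P3_P2_free_no_P3 (G : sgraph) (u v : G) :
  induced_free (disjoint_union (path_graph 3) (path_graph 2)) G -> adj u v ->
  no_P3 (~: (nbh u :|: nbh v)).
Proof.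
move=> free uv x y z; rewrite !inE !negb_or.
move=> /andP[/negbTE ux /negbTE vx] /andP[/negbTE uy /negbTE vy].
move=> /andP[/negbTE uz /negbTE vz] xy yz /andP[xz /negbTE nxz].
pose g (t : disjoint_union (path_graph 3) (path_graph 2)) : G := match t with
  | inl i => nth x [:: x; y; z] i
  | inr i => nth u [:: u; v] i
  end.
have g_adj s t : adj (g s) (g t) = adj s t.
  case: s => [[[|[|[|i]]] Hi]|[[|[|i]] Hi]] //;
    case: t => [[[|[|[|j]]] Hj]|[[|[|j]] Hj]] //=;
    rewrite /path_adj /= ?adj_irrefl //; rewrite ?adj_irrefl // adj_sym //.
apply: (free _ (embedding_isomorphic (g := g) _ g_adj)) => s t gst.
have: adj s t = false by rewrite -g_adj gst adj_irrefl.
case: s gst => [i|i]; case: t => [j|j] //= gst.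
- have xyz : uniq [:: x; y; z] by rewrite /= !inE negb_or xz !adj_neq.
  by move=> _; congr inl; apply/val_inj/eqP; rewrite -(nth_uniq x _ _ xyz) ?ltn_ord ?gst.
(* A vertex of the path differs from each of u and v, since it is not adjacent
   to the other one. *)
- case: j gst => [[|[|j]] Hj] //= gst _.
    by have := g_adj (inl i) (inr ord_max); rewrite /= gst uv.
  by have := g_adj (inl i) (inr ord0); rewrite /= gst adj_sym uv.
- case: i gst => [[|[|i]] Hi] //= gst _.
    by have := g_adj (inl j) (inr ord_max); rewrite /= -gst uv.
  by have := g_adj (inl j) (inr ord0); rewrite /= -gst adj_sym uv.
- have uniq_uv : uniq [:: u; v] by rewrite /= inE adj_neq.
  by move=> _; congr inr; apply/val_inj/eqP; rewrite -(nth_uniq u _ _ uniq_uv) ?ltn_ord ?gst.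
Qed.

(** * Colouring tools *)

Lemma colors_in_setU (G : sgraph) (A B : {set G}) (k l : nat) :
  colors_in A k -> colors_in B l -> colors_in (A :|: B) (k + l).
Proof.
move=> [c [c_lt cP]] [d [d_lt dP]].
exists (fun x => if x \in A then c x else k + d x); split=> [x|x y].
  rewrite inE; have [xA _|_ /= xB] := boolP (x \in A).
    by apply: leq_trans (c_lt x xA) (leq_addr _ _).
  by rewrite ltn_add2l d_lt.
rewrite !inE; have [xA _|_ /= xB] := boolP (x \in A);
  have [yA _|_ /= yB] := boolP (y \in A) => xy.
- exact: cP.
- by rewrite neq_ltn (leq_trans (c_lt x xA)) ?leq_addr.
- by rewrite neq_ltn (leq_trans (c_lt y yA)) ?leq_addr ?orbT.
- by rewrite eqn_add2l dP.
Qed.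

Lemma colors_inS (G : sgraph) (A B : {set G}) (k l : nat) :
  A \subset B -> k <= l -> colors_in B k -> colors_in A l.
Proof.
move=> /subsetP AB kl [c [c_lt cP]]; exists c; split=> [x /AB /c_lt|x y /AB + /AB].
  by move/leq_trans; apply.
exact: cP.
Qed.

Lemma chromatic_number_le (G : sgraph) (k : nat) :
  colors_in [set: G] k -> chromatic_number G <= k.
Proof.
move=> [c [c_lt cP]]; rewrite /chromatic_number; case: ex_minnP => m _; apply.
have c_lt' x : c x < k by apply: c_lt.
apply/existsP; exists [ffun x => Ordinal (c_lt' x)].
apply/forallP=> x; apply/forallP=> y; apply/implyP=> xy.
by rewrite !ffunE -val_eqE /= cP.
Qed.

Lemma greedy_coloring (G : sgraph) (A : {set G}) (k : nat) :
  (forall x, x \in A -> #|A :&: nbh x| < k) -> colors_in A k.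
Proof.
have [n] := ubnP #|A|; elim: n A => // n IHn A; rewrite ltnS => A_n degA.
have [->|[x xA]] := set_0Vmem A.
  by exists (fun=> 0); split=> [x|x y]; rewrite inE.
have [||c [c_lt cP]] := IHn (A :\ x).
- by rewrite (leq_trans _ A_n) // [ltnRHS](cardsD1 x) xA.
- move=> y; rewrite in_setD1 => /andP[_ yA]; apply: leq_ltn_trans (degA y yA).
  by rewrite subset_leq_card ?setSI ?subD1set.
have [i i_lt i_free] : exists2 i, i < k & i \notin [seq c y | y in A :&: nbh x].
  have : ~~ all (mem [seq c y | y in A :&: nbh x]) (iota 0 k).
    apply: contraL (degA x xA) => /allP iota_sub; rewrite -leqNgt.
    have := uniq_leq_size (iota_uniq 0 k) iota_sub.
    by rewrite size_iota size_map -cardE.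
  by case/allPn=> i; rewrite mem_iota; exists i.
have nbr_free y : y \in A -> adj x y -> c y != i.
  move=> yA xy; apply: contraNneq i_free => <-.
  by apply: image_f; rewrite !inE yA.
exists (fun y => if y == x then i else c y); split=> [y yA|y z yA zA yz].
  by case: eqP => // /eqP yx; rewrite c_lt // in_setD1 yx.
case: (eqVneq y x) yz => [->|yx]; case: (eqVneq z x) => [->|zx] yz.
- by rewrite adj_irrefl in yz.
- by rewrite eq_sym nbr_free.
- by rewrite nbr_free // adj_sym.
- by rewrite cP // in_setD1 ?yx ?zx.
Qed.

(** * Clique bounds *)

Lemma cliques_leS (G : sgraph) (A B : {set G}) (k l : nat) :
  A \subset B -> k <= l -> cliques_le B k -> cliques_le A l.
Proof. by move=> AB kl B_k Q QA /B_k Qk; apply: leq_trans kl; apply/Qk/(subset_trans QA). Qed.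

Lemma cliqueP (G : sgraph) (Q : {set G}) :
  reflect (forall x y, x \in Q -> y \in Q -> x != y -> adj x y) (clique Q).
Proof.
apply: (iffP forall_inP) => [Q_adj x y xQ yQ xy|Q_adj x xQ].
  exact: (implyP (forall_inP (Q_adj x xQ) y yQ)).
by apply/forall_inP=> y yQ; apply/implyP; apply: Q_adj.
Qed.

Lemma clique1 (G : sgraph) (x : G) : clique [set x].
Proof. by apply/cliqueP=> y z; rewrite !inE => /eqP-> /eqP->; rewrite eqxx. Qed.

Lemma clique2 (G : sgraph) (x y : G) : adj x y -> clique [set x; y].
Proof.
move=> xy; apply/cliqueP=> s t; rewrite !inE.
by move=> /orP[]/eqP-> /orP[]/eqP->; rewrite ?eqxx // adj_sym.
Qed.

Lemma cliques_le_clique_number (G : sgraph) (A : {set G}) :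
  cliques_le A (clique_number G).
Proof. by move=> Q _ Q_clique; apply: leq_bigmax_cond. Qed.

Lemma colors_in_cliques_le1 (G : sgraph) (A : {set G}) :
  cliques_le A 1 -> colors_in A 1.
Proof.
move=> A_1; exists (fun=> 0); split=> // x y xA yA xy.
have := A_1 [set x; y] _ (clique2 xy).
by rewrite subUset !sub1set xA yA cards2 (adj_neq xy) => /(_ isT).
Qed.

(** Cliques of A extend by the whole of Q, so they leave room for it. *)
Lemma cliques_le_complete (G : sgraph) (A Q : {set G}) (k : nat) :
  cliques_le (A :|: Q) (k + #|Q|) -> clique Q ->
  (forall x q, x \in A -> q \in Q -> adj x q) -> cliques_le A k.
Proof.
move=> AQ_k /cliqueP Q_clique AQ K KA /cliqueP K_clique.
have KQ0 : [disjoint K & Q].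
  apply/pred0P=> x /=; apply/negbTE/negP=> /andP[/(subsetP KA) xA xQ].
  by have := AQ _ _ xA xQ; rewrite adj_irrefl.
have := AQ_k (K :|: Q); rewrite cardsU disjoint_setI0 // cards0 subn0 leq_add2r.
apply; first by rewrite setSU.
apply/cliqueP=> x y; rewrite !inE => /orP[xK|xQ] /orP[yK|yQ] xy.
- exact: K_clique.
- by apply: AQ => //; apply: (subsetP KA).
- by rewrite adj_sym; apply: AQ => //; apply: (subsetP KA).
- exact: Q_clique.
Qed.

Lemma cliques_le_nbh (G : sgraph) (v : G) (k : nat) :
  clique_number G <= k.+1 -> cliques_le (nbh v) k.
Proof.
move=> G_k; apply: (@cliques_le_complete _ _ [set v]).
- rewrite cards1 addn1; apply: cliques_leS (subsetT _) G_k _.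
  exact: cliques_le_clique_number.
- exact: clique1.
- by move=> x y; rewrite !inE => vx /eqP->; rewrite adj_sym.
Qed.

(** Without induced P3 every closed neighbourhood in A is a clique, so greedy
    colouring never needs more than k colours. *)
Lemma colors_in_no_P3 (G : sgraph) (A : {set G}) (k : nat) :
  no_P3 A -> cliques_le A k -> colors_in A k.
Proof.
move=> noP3 A_k; apply: greedy_coloring => x xA.
have <- : #|x |: (A :&: nbh x)| = #|A :&: nbh x|.+1.
  by rewrite cardsU1 !inE adj_irrefl andbF.
apply: A_k; first by rewrite subUset sub1set xA subsetIl.
apply/cliqueP=> y z; rewrite !inE => /orP[/eqP->|/andP[yA xy]] /orP[/eqP->|/andP[zA xz]] // yz.
- by rewrite eqxx in yz.
- by rewrite adj_sym.
- by apply/negPn/negP=> nyz; apply: (noP3 y x z) => //; rewrite /anti ?yz // adj_sym.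
Qed.

(** The bound R(3, k + 1) <= C(k + 2, 2).  The neighbours of a vertex x have
    smaller cliques, and its nonneighbours form a clique because x would
    complete a nonadjacent pair of them to an independent triple; Pascal's rule
    adds up the two counts. *)
Lemma ramsey3 (G : sgraph) (A : {set G}) (k : nat) :
  no_indep3 A -> cliques_le A k -> #|A| < 'C(k.+2, 2).
Proof.
elim: k A => [|k IHk] A noI3 A_k; have [->|[x xA]] := set_0Vmem A; rewrite ?cards0 ?bin_gt0 //.
  by have := A_k [set x]; rewrite sub1set cards1 => /(_ xA (clique1 x)).
have nbr_card : #|A :&: nbh x| < 'C(k.+2, 2).
  apply: IHk => [y z t /setIP[yA _] /setIP[zA _] /setIP[tA _]|]; first exact: noI3.
  apply: (@cliques_le_complete _ _ [set x]).
  - by rewrite cards1 addn1; apply: cliques_leS A_k => //; rewrite subUset sub1set xA subsetIl.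
  - exact: clique1.
  - by move=> y z; rewrite !inE => /andP[_ xy] /eqP->; rewrite adj_sym.
have anti_card : #|(A :\ x) :\: nbh x| <= k.+1.
  apply: A_k; first by rewrite (subset_trans (subsetDl _ _)) ?subD1set.
  apply/cliqueP=> y z; rewrite !inE => /and3P[xy yx yA] /and3P[xz zx zA] yz.
  apply/negPn/negP=> nyz.
  by apply: (noI3 x y z) => //; rewrite /anti ?(eq_sym x) ?yx ?zx ?xy ?xz ?yz.
have -> : #|A| = (#|A :&: nbh x| + #|(A :\ x) :\: nbh x|).+1.
  rewrite (cardsD1 x A) xA -(cardsID (nbh x) (A :\ x)); congr (_ + _).+1.
  by apply: eq_card => y; rewrite !inE; case: eqP => // ->; rewrite adj_irrefl !andbF.
by rewrite binS bin1; lia.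
Qed.

(** * The three parts of the graph *)

(** The colours of the clique C are reused on all vertices of D that miss some
    vertex of C: two such vertices sharing the colour of x both miss x, so
    they are not adjacent.  Each clique among the remaining vertices of D
    extends C, which leaves k - |C| fresh colours for them. *)
Lemma colors_in_clique_no_P3 (G : sgraph) (C D : {set G}) (k : nat) :
  clique C -> no_P3 D ->
  (forall x y z, x \in C -> y \in D -> z \in D -> adj y z -> adj x y || adj x z) ->
  cliques_le (C :|: D) k -> colors_in (C :|: D) k.
Proof.
move=> C_clique noP3 hit CD_k.
have C_k : #|C| <= k by apply: CD_k; rewrite ?subsetUl.
pose full := [set y in D | C \subset nbh y].
have full_colors : colors_in full (k - #|C|).
  apply: colors_in_no_P3 => [x y z|].
    by rewrite !inE => /andP[xD _] /andP[yD _] /andP[zD _]; apply: noP3.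
  apply: (@cliques_le_complete _ _ C) => // [|y x].
    rewrite subnK // setUC; apply: cliques_leS CD_k => //.
    by rewrite setUS //; apply/subsetP=> y; rewrite inE => /andP[].
  by rewrite inE => /andP[_ /subsetP CD] /CD; rewrite inE.
(* rep y is the vertex of C whose colour y takes; on D :\: full the default is
   never reached. *)
pose rep y := if y \in C then y else odflt y [pick x in C | ~~ adj x y].
have rep_C y : y \in C :|: (D :\: full) -> rep y \in C.
  rewrite /rep !inE; case: ifP => //= yC /andP[+ yD]; rewrite yD /=.
  case: pickP => [x /andP[]|none] //= /subsetP[] x xC; rewrite inE adj_sym.
  by have := none x; rewrite xC /= => /negbFE.
have rep_nadj y : y \in C :|: (D :\: full) -> y \notin C -> ~~ adj (rep y) y.
  move=> yCD yC; have := rep_C y yCD; rewrite /rep (negbTE yC).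
  by case: pickP => [x /andP[]|_] //=; rewrite (negbTE yC).
have rest_colors : colors_in (C :|: (D :\: full)) #|C|.
  exists (fun y => index (rep y) (enum C)); split=> [y yCD|y z yCD zCD yz].
    by rewrite cardE index_mem mem_enum rep_C.
  apply: contraL yz => /eqP/(congr1 (nth y (enum C))).
  rewrite !nth_index ?mem_enum ?rep_C // => rep_yz.
  have [yC|yC] := boolP (y \in C); have [zC|zC] := boolP (z \in C).
  - by move: rep_yz; rewrite /rep yC zC => ->; rewrite adj_irrefl.
  - by move: rep_yz (rep_nadj z zCD zC); rewrite {1}/rep yC => ->.
  - by move: rep_yz (rep_nadj y yCD yC); rewrite {2}/rep zC => ->; rewrite adj_sym.
  - have [yD zD] : y \in D /\ z \in D.
      by move: yCD zCD; rewrite !inE (negbTE yC) (negbTE zC) => /andP[_ ->] /andP[_ ->].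
    apply: contra (rep_nadj y yCD yC) => yz.
    have /orP[//|] := hit (rep y) y z (rep_C y yCD) yD zD yz.
    by rewrite rep_yz (negbTE (rep_nadj z zCD zC)).
have -> : k = #|C| + (k - #|C|) by rewrite subnKC.
apply: colors_inS (colors_in_setU rest_colors full_colors) => //.
apply/subsetP=> y; rewrite !inE; case: (y \in C) => //= ->.
by rewrite andbT orNb.
Qed.

(** Within N(u) a vertex x has fewer than C(k + 2, 2) neighbours: by
    crown-freeness they contain no independent triple, and u and x extend
    their cliques. *)
Lemma colors_in_nbh (G : sgraph) (u : G) (k : nat) :
  induced_free crown G -> clique_number G <= k.+2 -> colors_in (nbh u) 'C(k.+2, 2).
Proof.
move=> crown_free G_k; apply: greedy_coloring => x; rewrite inE => ux.
apply: ramsey3; first exact: crown_free_no_indep3.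
apply: (@cliques_le_complete _ _ [set u; x]); last first.
- by move=> y z; rewrite !inE => /andP[uy xy] /orP[]/eqP->; rewrite adj_sym.
- exact: clique2.
- rewrite cards2 (adj_neq ux) addn2; apply: cliques_leS (subsetT _) G_k _.
  exact: cliques_le_clique_number.
Qed.

(** With Y the set to be coloured, split it by adjacency to w into a clique
    and a set without induced P3.  The vertex u is left out of Y, and serves
    as the third leaf of a crown and as an end of a P3 or P2. *)
Lemma colors_in_nbhD (G : sgraph) (u v w : G) (k : nat) :
  induced_free crown G ->
  induced_free (disjoint_union (path_graph 3) (path_graph 2)) G ->
  adj u v -> adj u w -> adj v w ->
  clique_number G <= k.+1 -> colors_in ((nbh v :\: nbh u) :\ u) k.
Proof.
move=> crown_free P3P2_free uv uw vw G_k.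
set Y := (nbh v :\: nbh u) :\ u.
have [vu wu] : adj v u /\ adj w u by rewrite !(adj_sym _ u).
have inY y : y \in Y -> [/\ y != u, ~~ adj u y & adj v y].
  by rewrite !inE => /and3P[].
rewrite -(setID Y (nbh w)); apply: colors_in_clique_no_P3.
(* A nonadjacent pair x, y would give a crown on the edge v w with leaves
   u, x, y. *)
- apply/cliqueP=> x y; rewrite !in_setI => /andP[/inY[xu ux vx] wx] /andP[/inY[yu uy vy] wy] xy.
  rewrite !inE in wx wy; apply/negPn/negP=> nxy.
  apply: (crown_free_no_indep3 crown_free vw (x := u) (y := x) (z := y));
    by rewrite ?inE /anti ?vu ?wu ?vx ?wx ?vy ?wy ?(eq_sym u) ?xu ?yu ?ux ?uy ?xy.
- move=> x y z; rewrite !in_setD !inE.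
  move=> /and4P[wx _ ux _] /and4P[wy _ uy _] /and4P[wz _ uz _].
  by apply: (P3_P2_free_no_P3 P3P2_free uw); rewrite !inE negb_or ?ux ?uy ?uz.
(* An edge y z missed by x is anticomplete to the induced path u, w, x. *)
- move=> x y z; rewrite !inE => /andP[/and3P[xu ux _] wx].
  move=> /and4P[wy _ uy _] /and4P[wz _ uz _] yz; apply/negPn/negP; rewrite negb_or => /andP[xy xz].
  apply: (P3_P2_free_no_P3 P3P2_free yz (x := u) (y := w) (z := x)) => //;
    rewrite ?inE ?negb_or /anti ?(eq_sym u) ?xu ?(adj_sym y) ?(adj_sym z);
    by rewrite ?uy ?uz ?wy ?wz ?xy ?xz.
- rewrite setID; apply: cliques_leS _ (leqnn _) (cliques_le_nbh G_k).
  exact: subset_trans (subD1set _ _) (subsetDl _ _).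
Qed.

(** * The bound *)

Lemma chromatic_number_edge (G : sgraph) (u v : G) (k : nat) :
  induced_free crown G ->
  induced_free (disjoint_union (path_graph 3) (path_graph 2)) G ->
  adj u v -> clique_number G <= k.+2 ->
  colors_in ((nbh v :\: nbh u) :\ u) k.+1 ->
  chromatic_number G <= 'C(k.+2, 2) + k.+2 + k.+1 + 1.
Proof.
move=> crown_free P3P2_free uv G_k Y_colors; apply: chromatic_number_le.
have far_colors : colors_in (~: (nbh u :|: nbh v)) k.+2.
  apply: colors_in_no_P3; first exact: P3_P2_free_no_P3.
  apply: cliques_leS (subsetT _) G_k _; exact: cliques_le_clique_number.
have u_colors : colors_in [set u] 1.
  by apply: colors_in_cliques_le1 => Q /subset_leq_card + _; rewrite cards1.
apply: colors_inS _ (leqnn _) (colors_in_setU (colors_in_setU (colors_in_setU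
  (colors_in_nbh u crown_free G_k) far_colors) Y_colors) u_colors).
apply/subsetP=> x _; rewrite !inE.
by case: (adj u x); case: (adj v x); case: (x == u).
Qed.

Lemma max_clique (G : sgraph) : exists2 Q : {set G}, clique Q & #|Q| = clique_number G.
Proof.
have [|Q Q_clique Q_max] := @eq_bigmax_cond _ [pred A : {set G} | clique A] (fun A => #|A|).
  by apply/card_gt0P; exists set0; apply/cliqueP=> x y; rewrite inE.
by exists Q => //; rewrite -Q_max.
Qed.

(** The edge u v is taken in a maximum clique, which supplies the common
    neighbour of u and v as soon as the clique number is at least 3. *)
Lemma double_chromatic_number_le (G : sgraph) :
  induced_free crown G ->
  induced_free (disjoint_union (path_graph 3) (path_graph 2)) G ->
  (chromatic_number G).*2 <= clique_number G ^ 2 + 3 * clique_number G + 2.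
Proof.
move=> crown_free P3P2_free.
have [Q /cliqueP Q_clique Q_card] := max_clique G.
have [G_1|G_2] := leqP (clique_number G) 1.
  suff : chromatic_number G <= 1 by lia.
  apply/chromatic_number_le/colors_in_cliques_le1.
  by apply: cliques_leS (subxx _) G_1 _; apply: cliques_le_clique_number.
have [k G_k] : exists k, clique_number G = k.+2 by exists (clique_number G).-2; lia.
have [u [v [uv Y_colors]]] :
    exists u v : G, adj u v /\ colors_in ((nbh v :\: nbh u) :\ u) k.+1.
  case: k G_k => [|k] G_k.
    (* Clique number 2: v extends every clique among its neighbours. *)
    have /card_gt1P[u [v [uQ vQ uv]]] : 1 < #|Q| by rewrite Q_card.
    exists u, v; split; first exact: Q_clique.
    apply: colors_in_cliques_le1; apply: cliques_leS _ (leqnn _) (cliques_le_nbh (v := v) _).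
      exact: subset_trans (subD1set _ _) (subsetDl _ _).
    by rewrite G_k.
  have /card_gt2P[u [v [w [[uQ vQ wQ] [uv vw wu]]]]] : 2 < #|Q| by rewrite Q_card G_k.
  exists u, v; split; first exact: Q_clique.
  apply: (@colors_in_nbhD _ _ _ w); rewrite ?G_k //; apply: Q_clique => //.
  by rewrite eq_sym.
have := chromatic_number_edge crown_free P3P2_free uv (eq_leq G_k) Y_colors.
(* This identity is the closed form of C(k + 2, 2). *)
have := mul_bin_diag k.+2 1; rewrite /= G_k bin1; nia.
Qed.

Import Order.TTheory GRing.Theory Num.Theory.
Local Open Scope ring_scope.

Theorem theorem1p3 (G : sgraph)
    (crown_free : induced_free crown G)
    (P3_P2_free : induced_free (disjoint_union (path_graph 3) (path_graph 2)) G) :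
  (chromatic_number G)%:R
    <= 1 / 2 * (clique_number G)%:R ^+ 2 + 3 / 2 * (clique_number G)%:R + 1
    :> rat.
Proof.
have := double_chromatic_number_le crown_free P3_P2_free.
rewrite -(ler_nat rat) -mul2n !natrD !natrM; lra.
Qed.
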